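(* Let $\Gamma$ be an Abelian group of order $n^2>1$. There exists a $\Gamma$-magic square $\mathrm{MS}_{\Gamma}(n)$ of side $n$ if and only if $n>2$.
   Context: For an Abelian group $(\Gamma,+)$ of order $n^2$, a $\Gamma$-magic square $\mathrm{MS}_{\Gamma}(n)$ (of side $n$) is an $n\times n$ array whose entries are all the elements of $\Gamma$ (each element appearing exactly once) such that all row sums, all column sums, the sum along the main diagonal and the sum along the backward main diagonal are equal to the same element $\mu\in\Gamma$. *)

(* Defs.v *)
From mathcomp Require Import all_boot all_order all_algebra.

Set Implicit Arguments.
Unset Strict Implicit.
Unset Printing Implicit Defensive.

Import GRing.Theory.
Local Open Scope ring_scope.

Definition is_magic_square (G : finZmodType) (n : nat) (A : 'M[G]_n) : Prop :=
  bijective (fun p : 'I_n * 'I_n => A p.1 p.2) /\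
  exists mu : G,
    [/\ forall i : 'I_n, \sum_(j < n) A i j = mu,
        forall j : 'I_n, \sum_(i < n) A i j = mu,
        \sum_(i < n) A i i = mu
      & \sum_(i < n) A i (rev_ord i) = mu].

(* Main.v *)
(* Call a sequence a_0, ..., a_(n-1) balanced when a_i + a_(n-1-i) does not depend
   on i.  Climbing through subgroups of successive prime index and using mixed
   radix expansions, every order n1 n2 dividing |G| is realised by a subgroup each
   of whose elements is uniquely a_i + b_j, with a and b balanced of lengths n1
   and n2.  A magic square is then obtained by distributing the sums a_i + b_j:
   - for n odd, by the Siamese method;
   - for 4 | n, by starting from a_j + b_i and replacing (i, j) by its opposite
     cell on half of the cells, as in the classical doubly even squares;
   - for n = 2m with m odd, by inflating an odd square over the subgroup of order
     m^2 to 2 x 2 blocks labelled by the elements of a subgroup of order 4.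
   For n = 2 the first row and the first column force a repeated entry. *)
Require Import Defs.
From mathcomp Require Import all_boot all_order all_algebra.
From mathcomp Require Import all_fingroup cyclic pgroup.
From mathcomp Require Import zify.

Set Implicit Arguments.
Unset Strict Implicit.
Unset Printing Implicit Defensive.

Import GRing.Theory.
Local Open Scope ring_scope.

(** * Balanced sequences and factorizations of subgroups *)

Definition balanced (G : zmodType) (n : nat) (a : 'I_n -> G) : Prop :=
  exists g, forall i, a i + a (rev_ord i) = g.

Lemma sum_balanced (G : zmodType) (n : nat) (a : 'I_n -> G) (g : G) :
  (forall i, a i + a (rev_ord i) = g) -> (\sum_i a i) *+ 2 = g *+ n.
Proof.
move=> ag; rewrite mulr2n {2}(reindex_inj rev_ord_inj) -big_split /=.
by rewrite (eq_bigr _ (fun i _ => ag i)) sumr_const card_ord.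
Qed.

Section BalancedFactorization.

Variable G : finZmodType.
Implicit Types (Y Z : {group G}) (p n : nat).

(** Cauchy's theorem in the quotient by [Y] gives a class of order [p]; [Z] is the preimage of the
    cyclic group it generates and [x] a representative. *)
Lemma subgroup_extension Y p :
    prime p -> (p * #|Y| %| #|G|)%N ->
  exists Z (x : G),
    [/\ #|Z| = (p * #|Y|)%N, Y \subset Z, x \in Z
      & forall c, x *+ c \in Y -> (p %| c)%N].
Proof.
move=> p_pr dvd_pY.
have nYG : ([set: G] \subset 'N(Y))%g.
  exact: sub_abelian_norm (FinRing.zmod_abelian _) (subsetT _).
have dvd_p : (p %| #|([set: G] / Y)%g|)%N.
  rewrite card_quotient // -divgS ?subsetT // cardsT dvdn_divRL //.
  by apply: dvdn_trans dvd_pY; rewrite dvdn_mull.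
have [_ /morphimP[x nYx _ ->] ox] := Cauchy p_pr dvd_p.
exists (coset Y @*^-1 <[coset Y x]>)%G, x; split.
- by rewrite /= card_cosetpre -orderE ox mulnC.
- exact: sub_cosetpre.
- by rewrite mem_morphpre ?cycle_id.
- move=> c xcY; rewrite -ox order_dvdn -morphX //.
  by apply/eqP; apply: coset_id.
Qed.

Definition balanced_factorization n1 n2 : Prop :=
  exists Y (a : 'I_n1 -> G) (b : 'I_n2 -> G),
    [/\ #|Y| = (n1 * n2)%N, balanced a, balanced b,
        forall i j, a i + b j \in Y
      & injective (fun ij => a ij.1 + b ij.2)].

Lemma balanced_factorization_sym n1 n2 :
  balanced_factorization n1 n2 -> balanced_factorization n2 n1.
Proof.
case=> Y [a [b [cardY ba bb abY ab_inj]]]; exists Y, b, a; split=> //.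
- by rewrite mulnC.
- by move=> i j; rewrite addrC.
- move=> [i j] [i' j'] /=; rewrite addrC [RHS]addrC.
  by move/(ab_inj (j, i) (j', i'))=> [-> ->].
Qed.

Lemma balanced_factorization1 : balanced_factorization 1 1.
Proof.
exists 1%G, (fun=> 0), (fun=> 0); split.
- by rewrite cards1.
- by exists (0 + 0).
- by exists (0 + 0).
- by move=> i j; rewrite addr0 inE.
- by move=> [i j] [i' j'] _; rewrite !ord1.
Qed.

Lemma quotient_ord_subproof p n (j : 'I_(p * n)) : (j %/ p < n)%N.
Proof.
case: j => j /= ltj; case: p ltj => // p ltj.
by rewrite ltn_divLR // mulnC.
Qed.

(* Complementing a mixed radix numeral complements each digit, so prepending a
   digit that counts multiples of [x] keeps a sequence balanced. *)
Lemma balanced_factorization_step p n1 n2 :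
    prime p -> (p * (n1 * n2) %| #|G|)%N ->
  balanced_factorization n1 n2 -> balanced_factorization (p * n1) n2.
Proof.
move=> p_pr dvdG [Y [a [b [cardY [g ag] bb abY ab_inj]]]].
rewrite -cardY in dvdG.
have [Z [x [cardZ YZ xZ x_ord]]] := subgroup_extension p_pr dvdG.
pose quo (j : 'I_(p * n1)) := Ordinal (quotient_ord_subproof j).
have p_gt0 := prime_gt0 p_pr.
exists Z, (fun j : 'I_(p * n1) => x *+ (j %% p) + a (quo j)), b; split=> //.
- by rewrite cardZ cardY mulnA.
- exists (x *+ p.-1 + g) => j.
  have ltj := ltn_ord j.
  have jE := divn_eq j p; have ltjp : (j %% p < p)%N by rewrite ltn_mod.
  have ltq : (j %/ p < n1)%N := ltn_ord (quo j).
  have revE : (rev_ord j = (n1 - (j %/ p).+1) * p + (p - (j %% p).+1) :> nat)%N.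
    rewrite /= {1}jE; move: (j %/ p)%N (j %% p)%N ltq ltjp => q r ltq ltr.
    have -> : (n1 = (n1 - q.+1) + q.+1)%N by lia.
    move: (n1 - q.+1)%N => s; nia.
  have -> : quo (rev_ord j) = rev_ord (quo j).
    apply: val_inj; change (rev_ord j %/ p = n1 - (j %/ p).+1)%N.
    rewrite revE divnMDl //.
    by rewrite (@divn_small (p - _)) ?addn0 // ltn_subrL.
  rewrite revE modnMDl (@modn_small (p - _)); last by rewrite ltn_subrL.
  rewrite addrACA ag -mulrnDr; congr (x *+ _ + g).
  by move: (j %% p)%N ltjp => r; lia.
- move=> i j; rewrite -addrA -FinRing.zmodMgE -FinRing.zmodXgE.
  by rewrite groupM ?groupX // (subsetP YZ).
- move=> [i j] [i' j'] /= eq_ij.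
  (* Low digits first: equal sums put some [x *+ c] with [c < p] in [Y], so [p] divides [c] and
     [c = 0]. Cancelling the multiples of [x] then leaves an equality in the old factorization. *)
  have eq_mod : (i %% p = i' %% p)%N.
    suff le_mod (k l : 'I_(p * n1)) (s t : 'I_n2) :
        x *+ (k %% p) + a (quo k) + b s = x *+ (l %% p) + a (quo l) + b t ->
        (l %% p <= k %% p)%N -> (k %% p = l %% p)%N.
      case: (leqP (i' %% p) (i %% p)) => [le_i | /ltnW le_i].
        exact: le_mod eq_ij le_i.
      exact/esym/(le_mod _ _ _ _ (esym eq_ij) le_i).
    rewrite -!addrA => eq_kl le_lk.
    have : x *+ (k %% p - l %% p) \in Y.
      rewrite mulrnBr //; have -> : x *+ (k %% p) - x *+ (l %% p) =
         (a (quo l) + b t) - (a (quo k) + b s).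
        apply/eqP; rewrite subr_eq addrAC -[X in _ == X - _]addrC -eq_kl.
        by rewrite addrK.
      by rewrite -FinRing.zmodMgE -FinRing.zmodVgE groupM ?groupV.
    move/x_ord/dvdn_leq; have := ltn_pmod k p_gt0; lia.
  move: eq_ij; rewrite eq_mod -!addrA => /addrI.
  move/(ab_inj (quo i, j) (quo i', j'))=> [eq_div ->].
  congr (_, _); apply: val_inj => /=.
  by rewrite (divn_eq i p) eq_div eq_mod -divn_eq.
Qed.

Lemma balanced_factorizationP n1 n2 :
  (n1 * n2 %| #|G|)%N -> balanced_factorization n1 n2.
Proof.
have G_gt0 : (0 < #|G|)%N by apply/card_gt0P; exists 0.
have grow m2 : balanced_factorization 1 m2 ->
    forall m1, (m1 * m2 %| #|G|)%N -> balanced_factorization m1 m2.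
  move=> fact1; elim/ltn_ind=> m1 IHm1 dvdG.
  have m1_gt0 : (0 < m1)%N.
    by case: m1 {IHm1} dvdG => //; rewrite dvd0n; case: #|G| G_gt0.
  have [m1_le1 | m1_gt1] := leqP m1 1; first by have -> : m1 = 1%N by lia.
  have := pdiv_prime m1_gt1; have /dvdnP[m] := pdiv_dvd m1.
  move: (pdiv m1) => p m1E p_pr; have p_gt1 := prime_gt1 p_pr.
  have dvdG' : (p * (m * m2) %| #|G|)%N by rewrite mulnA [(p * m)%N]mulnC -m1E.
  rewrite m1E mulnC; apply: balanced_factorization_step => //.
  apply: IHm1; first by rewrite m1E; nia.
  exact: dvdn_trans (dvdn_mull _ (dvdnn _)) dvdG'.
(* Grow one factor from 1 to [n2], swap the two factors, then grow the other to [n1]. *)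
move=> dvdG; apply: (grow n2 _ n1) => //.
apply/balanced_factorization_sym/grow; first exact: balanced_factorization1.
by rewrite muln1; apply: dvdn_trans dvdG; rewrite dvdn_mull.
Qed.

End BalancedFactorization.

(** * The Siamese index square of odd side *)

Lemma double_ord_inj (n : nat) : ~~ odd n -> injective (fun i : 'I_n.+1 => i + i).
Proof.
move=> even_n i j /(congr1 val) /=; move: (ltn_ord i) (ltn_ord j).
move=> lti ltj eq_ij; apply: val_inj => /=.
(* Both quotients are 0 or 1; if they differed, two even numbers would differ by the odd [n.+1]. *)
have := divn_eq (i + i) n.+1; have := divn_eq (j + j) n.+1.
have : ((i + i) %/ n.+1 < 2)%N by rewrite ltn_divLR //; lia.
have : ((j + j) %/ n.+1 < 2)%N by rewrite ltn_divLR //; lia.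
rewrite eq_ij; case: (_ %/ _)%N => [|[|//]]; case: (_ %/ _)%N => [|[|//]]; lia.
Qed.

(* The Siamese arrangement, shifted so that the first component takes the
   middle value along the backward diagonal and the second one along the main
   diagonal.  Factors 2 are kept because the middle term of a balanced sequence
   is determined by the sum of the sequence only up to 2-torsion. *)
Lemma odd_index_square (n : nat) :
  odd n ->
  exists q : 'I_n -> 'I_n -> 'I_n * 'I_n,
    injective (fun ij => q ij.1 ij.2) /\
    forall (G : zmodType) (a b : 'I_n -> G), balanced a -> balanced b ->
    let B i j := a (q i j).1 + b (q i j).2 in
    let S := \sum_i a i + \sum_i b i in
    [/\ forall i, \sum_j B i j = S,
        forall j, \sum_i B i j = S,
        (\sum_i B i i) *+ 2 = S *+ 2
      & (\sum_i B i (rev_ord i)) *+ 2 = S *+ 2].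
Proof.
case: n => // n /= even_n; have dbl_inj := double_ord_inj even_n.
pose mid : 'I_n.+1 := inord n./2.
have midE : rev_ord mid = mid.
  apply: val_inj => /=; rewrite inordK; last by lia.
  lia.
have revE (i : 'I_n.+1) : rev_ord i = ord_max - i.
  apply/eqP; rewrite eq_sym subr_eq; apply/eqP/val_inj => /=.
  have := ltn_ord i; rewrite subSS => lti.
  by rewrite subnK ?modn_small.
(* Since [i + rev_ord i = ord_max], this shift makes the first component [mid] on the backward
   diagonal. *)
pose c := mid - ord_max.
exists (fun i j => (i + j + c, i - j + mid)); split.
  move=> [i j] [i' j'] eq_ij.
  have /= /addIr eqD := congr1 fst eq_ij; have /= /addIr eqB := congr1 snd eq_ij.
  have eq_i : i = i'.
    have dblE (k l : 'I_n.+1) : k + k = (k + l) + (k - l).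
      by rewrite addrACA subrr addr0.
    by apply: dbl_inj; rewrite (dblE i j) (dblE i' j') eqD eqB.
  by move: eqD; rewrite eq_i => /addrI ->.
move=> G a b [g ag] [h bh].
have mid2 (d : 'I_n.+1 -> G) e : (forall i, d i + d (rev_ord i) = e) ->
    d mid *+ n.+1 *+ 2 = (\sum_i d i) *+ 2.
  by move=> de; rewrite (sum_balanced de) mulrnAC mulr2n -{2}midE de.
split.
- move=> i; rewrite big_split /=; congr (_ + _).
    rewrite [RHS](reindex_inj (h := fun j => i + j + c)) //.
    by move=> j j' /addIr /addrI.
  rewrite [RHS](reindex_inj (h := fun j => i - j + mid)) //.
  by move=> j j' /addIr /addrI /oppr_inj.
- move=> j; rewrite big_split /=; congr (_ + _).
    rewrite [RHS](reindex_inj (h := fun i => i + j + c)) //.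
    by move=> i i' /addIr /addIr.
  rewrite [RHS](reindex_inj (h := fun i => i - j + mid)) //.
  by move=> i i' /addIr /addIr.
- rewrite big_split /= !mulrnDl; congr (_ + _).
    rewrite [in RHS](reindex_inj (h := fun i => i + i + c)) //.
    by move=> i i' /addIr /dbl_inj.
  under eq_bigr do rewrite subrr add0r.
  by rewrite sumr_const card_ord (mid2 _ _ bh).
- rewrite big_split /= !mulrnDl; congr (_ + _).
    under eq_bigr => i _ do rewrite revE (addrC i) subrK /c addrC subrK.
    by rewrite sumr_const card_ord (mid2 _ _ ag).
  rewrite [in RHS](reindex_inj (h := fun i => i - rev_ord i + mid)) //.
  move=> i i' /addIr; rewrite !revE !opprB !addrA => /addIr.
  exact: dbl_inj.
Qed.

(** * Sides divisible by 4 *)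

Lemma sum_mod4 (V : nmodType) (m : nat) (F : nat -> V) :
  \sum_(j < m * 4) F (j %% 4)%N = (F 0%N + F 1%N + F 2%N + F 3%N) *+ m.
Proof.
elim: m => [|m IHm]; first by rewrite big_ord0.
rewrite mulSnr 4!addnS addn0 4!big_ord_recr /= IHm mulrSr.
rewrite -[(m * 4).+3]addn3 -[(m * 4).+2]addn2 -[(m * 4).+1]addn1.
by rewrite modnMl !modnMDl !addrA.
Qed.

(** An even length has no middle index, so pairing opposite indices gives the sum itself and not
    only its double. Reversal swaps the residues 0, 1 with 3, 2, so [low] selects one index of each
    pair. *)
Lemma balanced_sum_double (G : zmodType) (m : nat) (a : 'I_(m * 4) -> G) (g : G) :
  (forall i, a i + a (rev_ord i) = g) -> \sum_i a i = g *+ (m * 2).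
Proof.
move=> ag; pose low (i : 'I_(m * 4)) := (i %% 4 < 2)%N.
rewrite (bigID low) /= [X in _ + X](reindex_inj rev_ord_inj) /=.
have revL i : ~~ low (rev_ord i) = low i by have := ltn_ord i; rewrite /low /=; lia.
rewrite (eq_bigl _ _ revL) -big_split (eq_bigr _ (fun i _ => ag i)) /=.
rewrite big_mkcond (sum_mod4 m (fun k => if (k < 2)%N then g else 0)) /= !addr0.
by rewrite mulnC mulrnA.
Qed.

Lemma doubly_even_magic_square (G : finZmodType) (m : nat) (a b : 'I_(m * 4) -> G) :
    balanced a -> balanced b -> bijective (fun ij => a ij.1 + b ij.2) ->
  exists A : 'M[G]_(m * 4), is_magic_square A.
Proof.
move=> [g ag] [h bh] ab_bij.
pose e (i : 'I_(m * 4)) := ((i %% 4 == 0) || (i %% 4 == 3))%N.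
have e_rev i : e (rev_ord i) = e i by have := ltn_ord i; rewrite /e /=; lia.
pose A := \matrix_(i, j < m * 4)
  if e i == e j then a j + b i else a (rev_ord j) + b (rev_ord i).
(* Along a row, the [b] part is [b i] in half of the columns and [b (rev_ord i)] in the other half;
   columns behave likewise with [a]. *)
have balanced_half (d : 'I_(m * 4) -> G) c s : (forall i, d i + d (rev_ord i) = c) ->
    forall i, \sum_j (if s == e j then d i else d (rev_ord i)) = c *+ (m * 2).
  move=> dc i; rewrite (sum_mod4 m (fun k =>
    if s == ((k == 0) || (k == 3))%N then d i else d (rev_ord i))) /=.
  rewrite [in RHS](mulnC m) mulrnA mulr2n -(dc i); congr (_ *+ m).
  move: (d i) (d (rev_ord i)) => u v.
  by case: s; rewrite /= -[LHS]addrA [v + u]addrC.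
(* The reversed positions of a line form a set stable under [rev_ord], so the other part is merely
   permuted. *)
have twisted_sum (d : 'I_(m * 4) -> G) s :
    \sum_j (if s == e j then d j else d (rev_ord j)) = \sum_j d j.
  rewrite (bigID (fun j => s == e j)) [RHS](bigID (fun j => s == e j)) /=.
  congr (_ + _); first by apply: eq_bigr => j ->.
  rewrite [RHS](reindex_inj rev_ord_inj) /=.
  by apply: eq_big => [j | j /negPf ->]; rewrite ?e_rev.
have if_add (s : bool) (x y z t : G) :
    (if s then x + y else z + t) = (if s then x else z) + (if s then y else t).
  by case: s.
exists A; split.
  pose w (ij : 'I_(m * 4) * 'I_(m * 4)) :=
    if e ij.1 == e ij.2 then (ij.2, ij.1) else (rev_ord ij.2, rev_ord ij.1).
  have wK : involutive w.
    move=> [i j]; rewrite {2}/w /=.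
    case: (boolP (e i == e j)) => eij; rewrite /w /=.
      by rewrite eq_sym eij.
    by rewrite !e_rev eq_sym (negPf eij) !rev_ordK.
  apply: (eq_bij (bij_comp ab_bij (inv_bij wK))) => [[i j]] /=.
  by rewrite mxE /w /=; case: ifP.
exists (\sum_i a i + \sum_i b i); split.
- move=> i; under eq_bigr do rewrite mxE if_add.
  by rewrite big_split /= twisted_sum (balanced_half _ _ _ bh) (balanced_sum_double bh).
- move=> j; under eq_bigr do rewrite mxE eq_sym if_add.
  by rewrite big_split /= twisted_sum (balanced_half _ _ _ ag) (balanced_sum_double ag).
- under eq_bigr do rewrite mxE eqxx.
  by rewrite big_split.
- under eq_bigr do rewrite mxE e_rev eqxx.
  by rewrite big_split /= [X in _ = X + _](reindex_inj rev_ord_inj).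
Qed.

(** * Sides congruent to 2 modulo 4 *)

(** One formula serves both groups of order 4: in the cyclic case [x] is a generator and [y = 0];
    otherwise [t = 0, 1, 2, 3] gives [0, x, y, x + y]. Label sums then matter only modulo 4, and
    high-bit sums only modulo 2. *)
Lemma order4_coordinates (G : finZmodType) (P : {group G}) :
  #|P| = 4%N ->
  exists x y : G,
    [/\ x *+ 4 = 0, y *+ 2 = 0, forall t, x *+ t + y *+ t./2 \in P
      & {in gtn 4%N &, injective (fun t => x *+ t + y *+ t./2)}].
Proof.
move=> cardP; have [/existsP[x /andP[xP x2]] | /existsPn P2] :=
  boolP [exists x, (x \in P) && (x *+ 2 != 0)].
  have x4 : #[x]%g = 4%N.
    have : (#[x]%g %| 4)%N by rewrite -cardP order_dvdG.
    have : ~~ (#[x]%g %| 2)%N by rewrite order_dvdn.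
    by case: #[x]%g (order_gt0 x) => [|[|[|[|[|?]]]]] // _ _ /dvdn_leq; apply.
  exists x, 0; split.
  - by rewrite -FinRing.zmodXgE -x4 expg_order.
  - by rewrite mul0rn.
  - by move=> t; rewrite mul0rn addr0 -FinRing.zmodXgE groupX.
  - move=> s t lts ltt; rewrite !mul0rn !addr0 -!FinRing.zmodXgE => /eqP.
    by rewrite eq_expg_mod_order x4 !modn_small // => /eqP.
have {}P2 z : z \in P -> z *+ 2 = 0.
  by move=> zP; move: (P2 z); rewrite zP negbK => /eqP.
have card_P0 : #|P :\ (0 : G)| = 3%N.
  by apply: succn_inj; rewrite -[RHS]cardP (cardsD1 (0 : G) P) group1.
have [x /[dup] xP0 /setD1P[x0 xP]] : exists x, x \in P :\ (0 : G).
  by apply/card_gt0P; rewrite card_P0.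
have [y /setD1P[yx /setD1P[y0 yP]]] : exists y, y \in P :\ (0 : G) :\ x.
  apply/card_gt0P; rewrite -(ltn_add2l (x \in P :\ (0 : G))) -cardsD1 card_P0.
  by rewrite xP0.
exists x, y; split.
- by rewrite -[4%N]/(2 * 2)%N mulrnA (P2 _ xP) mul0rn.
- exact: P2 _ yP.
- by move=> t; rewrite -!FinRing.zmodXgE -FinRing.zmodMgE groupM ?groupX.
have f2 : x *+ 2 = 0 := P2 _ xP.
have f3 : x *+ 3 = x by rewrite mulrS f2 addr0.
have xy : x + y != 0.
  by apply: contra yx => /eqP/(congr1 (+%R x)); rewrite addrA -mulr2n f2 add0r addr0 => ->.
have ne1 : x + y != x by rewrite -subr_eq0 addrC addKr.
have ne2 : x + y != y by rewrite -subr_eq0 addrK.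
pose l := [:: 0; x; y; x + y].
have l_uniq : uniq l.
  by rewrite /= !inE !negb_or !(eq_sym 0) (eq_sym x y) (eq_sym x (x + y)) (eq_sym y (x + y))
             x0 y0 yx xy ne1 ne2.
have lE t : t \in gtn 4%N -> x *+ t + y *+ t./2 = l`_t.
  by case: t => [|[|[|[|//]]]] _; rewrite /= ?f2 ?f3 ?addr0 ?add0r.
move=> s t s4 t4 /=; rewrite (lE _ s4) (lE _ t4) => /eqP.
by rewrite nth_uniq // => /eqP.
Qed.

Lemma sum_half_ord (V : nmodType) (m : nat) (F : 'I_m.+1 -> V) :
  \sum_(i < m.+1 * 2) F (inord (i %/ 2)) = (\sum_i F i) *+ 2.
Proof.
have sum_half n (H : nat -> V) :
    \sum_(i < n * 2) H (i %/ 2)%N = (\sum_(i < n) H i) *+ 2.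
  elim: n => [|n IHn]; first by rewrite !big_ord0 mul0rn.
  rewrite mulSnr 2!addnS addn0 3!big_ord_recr /= IHn mulrnDl -addrA.
  by rewrite -[(n * 2).+1]addn1 mulnK // divnMDl // addn0 mulr2n.
rewrite (sum_half _ (fun k => F (inord k))); congr (_ *+ 2).
by apply: eq_bigr => i _; rewrite inord_val.
Qed.

(* The row and column pairs of the 6 x 6 table below are repeated 1, [k] and 1
   times. *)
Definition zone (k I : nat) : nat :=
  if (I == 0)%N then 0%N else if (I <= k)%N then 1%N else 2.

Definition stretch (k i : nat) : nat := (zone k (i %/ 2) * 2 + i %% 2)%N.

Definition weight (k : nat) (t : nat -> nat) : nat :=
  (t 0 + t 1 + k * (t 2 + t 3) + t 4 + t 5)%N.

Lemma sum_stretch (k : nat) (t : nat -> nat) :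
  (\sum_(i < k.+2 * 2) t (stretch k i) = weight k t)%N.
Proof.
have sum_mod2 n : (\sum_(0 <= i < n * 2) t (2 + i %% 2) = n * (t 2 + t 3))%N.
  elim: n => [|n IHn]; first by rewrite big_geq.
  rewrite mulSnr 2!addnS addn0 big_nat_recr // big_nat_recr //= IHn.
  by rewrite -[(n * 2).+1]addn1 modnMl modnMDl mulSnr !addnA.
rewrite -(big_mkord xpredT (fun i => t (stretch k i))).
have -> : (k.+2 * 2 = (k * 2).+4)%N by lia.
rewrite big_nat_recr // big_nat_recr // big_nat_recl // big_nat_recl //=.
rewrite (eq_big_nat _ _ (F2 := fun i => t (2 + i %% 2)%N)) => [|i lti].
  rewrite sum_mod2 /weight !addnA; congr (_ + _ + _ + _ + _)%N;
    by congr t; rewrite /stretch /zone; do 2?case: ifP => ?; lia.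
by congr t; rewrite /stretch /zone; do 2?case: ifP => ?; lia.
Qed.

Lemma weight_mod (k d : nat) (t : nat -> nat) :
  weight k t = weight (k %% d) t %[mod d].
Proof.
rewrite /weight {1}(divn_eq k d).
have -> u v w : (u + (k %/ d * d + k %% d) * (t 2 + t 3) + v + w =
    k %/ d * (t 2 + t 3) * d + (u + k %% d * (t 2 + t 3) + v + w))%N by lia.
exact: modnMDl.
Qed.

(* Found by computer search.  Every 2 x 2 block contains 0, 1, 2, 3 once, and all
   lines, weighted as in [weight], agree modulo 4, as do the corresponding sums
   of high bits modulo 2; the first table serves [k = 1 %[mod 4]] and the second
   one [k = 3 %[mod 4]]. *)
Definition block_table (s : bool) : seq (seq nat) :=
  if s then
    [:: [:: 0; 1; 0; 1; 0; 3];
        [:: 2; 3; 2; 3; 1; 2];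
        [:: 0; 1; 1; 0; 0; 3];
        [:: 3; 2; 2; 3; 1; 2];
        [:: 1; 0; 1; 2; 0; 1];
        [:: 3; 2; 3; 0; 3; 2]]%N
  else
    [:: [:: 0; 1; 0; 1; 0; 1];
        [:: 2; 3; 2; 3; 2; 3];
        [:: 0; 1; 0; 3; 0; 3];
        [:: 2; 3; 2; 1; 1; 2];
        [:: 0; 2; 0; 2; 1; 0];
        [:: 1; 3; 1; 3; 3; 2]]%N.

Definition block_label (s : bool) (c d : nat) : nat :=
  nth 0%N (nth [::] (block_table s) c) d.

Lemma block_label_lt4 s c d : (block_label s c d < 4)%N.
Proof.
rewrite /block_label; case: s; case: c => [|[|[|[|[|[|c]]]]]];
  by case: d => [|[|[|[|[|[|d]]]]]]; rewrite /= ?nth_nil.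
Qed.

Lemma block_label_inj s c d r1 r2 u1 u2 :
    (c < 3)%N -> (d < 3)%N ->
    (r1 < 2)%N -> (r2 < 2)%N -> (u1 < 2)%N -> (u2 < 2)%N ->
    block_label s (c * 2 + r1) (d * 2 + r2) =
    block_label s (c * 2 + u1) (d * 2 + u2) ->
  r1 = u1 /\ r2 = u2.
Proof.
by case: s; case: c => [|[|[|//]]]; case: d => [|[|[|//]]] _ _;
  case: r1 => [|[|//]]; case: r2 => [|[|//]];
  case: u1 => [|[|//]]; case: u2 => [|[|//]].
Qed.

(** By [weight_mod], only [k] modulo 4 matters, so for odd [k] the representatives 1 and 3 reduce
    the check to a finite computation. *)
Definition line_ok (s : bool) (t : nat -> nat) : Prop :=
  weight (if s then 1 else 3) t = 1 %[mod 4] /\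
  weight (if s then 1 else 3) (fun c => (t c)./2) = s %[mod 2].

Lemma block_label_lines s :
  [/\ forall c, (c < 6)%N -> line_ok s (block_label s c),
      forall d, (d < 6)%N -> line_ok s (block_label s ^~ d),
      line_ok s (fun c => block_label s c c)
    & line_ok s (fun c => block_label s c (5 - c))].
Proof.
by case: s; split=> // [[|[|[|[|[|[|//]]]]]] | [|[|[|[|[|[|//]]]]]]].
Qed.

Lemma mulrn_modn (V : zmodType) (x : V) (d m n : nat) :
  x *+ d = 0 -> m = n %[mod d] -> x *+ m = x *+ n.
Proof.
move=> xd0 eq_mn; have modE r : x *+ r = x *+ (r %% d).
  by rewrite {1}(divn_eq r d) mulrnDr mulnC mulrnA xd0 mul0rn add0r.
by rewrite modE eq_mn -modE.
Qed.

Lemma sum_line (V : zmodType) (x y : V) (k : nat) (t : nat -> nat) :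
    x *+ 4 = 0 -> y *+ 2 = 0 -> odd k -> line_ok (k %% 4 == 1)%N t ->
  \sum_(i < k.+2 * 2) (x *+ t (stretch k i) + y *+ (t (stretch k i))./2) =
  x + y *+ (k %% 4 == 1)%N.
Proof.
move=> x4 y2 odd_k [ok4 ok2].
have k4 : (k %% 4 = if k %% 4 == 1 then 1 else 3)%N by case: ifP => ?; lia.
have k2 : (k %% 2 = (if k %% 4 == 1 then 1 else 3) %% 2)%N by case: ifP => ?; lia.
rewrite big_split /= !sumrMnr !sum_stretch.
rewrite (sum_stretch k (fun c => (t c)./2)).
rewrite (mulrn_modn (n := 1) x4); last by rewrite (weight_mod k) k4.
congr (_ + _); apply: mulrn_modn y2 _.
by rewrite weight_mod k2 -weight_mod.
Qed.

Lemma stretch_lt6 k i : (stretch k i < 6)%N.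
Proof. by rewrite /stretch /zone; do 2?case: ifP => _; lia. Qed.

(** The repetition pattern 1, [k], 1 is symmetric, so the backward diagonal lands on that of the
    table. *)
Lemma stretch_rev k (i : 'I_(k.+2 * 2)) : stretch k (rev_ord i) = (5 - stretch k i)%N.
Proof.
have := ltn_ord i; rewrite /stretch /zone /=.
by do 2?case: ifP => ?; do 2?case: ifP => ?; lia.
Qed.

(* As in Conway's LUX method, each cell of an odd square over a subgroup [K] is
   expanded to a 2 x 2 block running through a coset of a complement [P] of
   order 4. *)
Lemma singly_even_magic_square (G : finZmodType) (k : nat) (K P : {group G})
    (a b : 'I_k.+2 -> G) :
    odd k -> #|G| = ((k.+2 * 2) ^ 2)%N -> #|K| = (k.+2 * k.+2)%N -> #|P| = 4%N ->
    balanced a -> balanced b -> (forall i j, a i + b j \in K) ->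
    injective (fun ij => a ij.1 + b ij.2) ->
  exists A : 'M[G]_(k.+2 * 2), is_magic_square A.
Proof.
move=> odd_k cardG cardK cardP ba bb abK ab_inj.
have [x [y [x4 y2 xyP xy_inj]]] := order4_coordinates cardP.
have odd_k2 : odd k.+2 by rewrite /= negbK.
have [q [q_inj /(_ G a b ba bb)[q_row q_col q_diag q_anti]]] := odd_index_square odd_k2.
pose B i j := a (q i j).1 + b (q i j).2.
pose half (i : 'I_(k.+2 * 2)) : 'I_k.+2 := inord (i %/ 2).
have halfE i : half i = (i %/ 2)%N :> nat by rewrite inordK //; have := ltn_ord i; lia.
have half_rev i : half (rev_ord i) = rev_ord (half i).
  apply: val_inj; change (half (rev_ord i) = k.+2 - (half i).+1 :> nat)%N.
  by rewrite !halfE /=; have := ltn_ord i; lia.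
pose s := (k %% 4 == 1)%N.
pose p t := x *+ t + y *+ t./2.
pose lab (i j : 'I_(k.+2 * 2)) := block_label s (stretch k i) (stretch k j).
have [lab_row lab_col lab_diag lab_anti] := block_label_lines s.
exists (\matrix_(i, j) (B (half i) (half j) + p (lab i j))); split.
  apply: inj_card_bij; last first.
    by rewrite cardG card_prod !card_ord -mulnn.
  move=> [i j] [i' j'] /=; rewrite !mxE => eq_ij.
  (* Equal entries give a difference lying in both [K], of odd order, and [P], of order 4; hence the
     base entries and the labels agree separately. *)
  have TI_KP : (K :&: P)%g = 1%g.
    apply: coprime_TIg; rewrite cardK cardP -[4%N]/(2 ^ 2)%N.
    by rewrite coprimeXr // coprimen2 oddM odd_k2.
  have diffE : p (lab i' j') - p (lab i j) = B (half i) (half j) - B (half i') (half j').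
    apply/eqP; rewrite subr_eq addrAC eq_sym subr_eq eq_ij.
    by rewrite [X in _ == X]addrC.
  have diff0 : B (half i) (half j) - B (half i') (half j') = 0.
    have subG (H : {group G}) u v : u \in H -> v \in H -> u - v \in H.
      by move=> uH vH; rewrite -FinRing.zmodVgE -FinRing.zmodMgE groupM ?groupV.
    apply/set1gP; rewrite -TI_KP; apply/setIP; split.
      by apply: subG; apply: abK.
    by rewrite -diffE; apply: subG; apply: xyP.
  move: diffE; rewrite diff0 => /eqP; rewrite subr_eq0 => /eqP/esym.
  move/(xy_inj _ _ (block_label_lt4 _ _ _) (block_label_lt4 _ _ _)) => eq_lab.
  move/eqP: diff0; rewrite subr_eq0 => /eqP eqB.
  have /(q_inj (half i, half j) (half i', half j')) eq_q :
      q (half i) (half j) = q (half i') (half j').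
    by apply: ab_inj; exact: eqB.
  have eq_i : (i %/ 2 = i' %/ 2)%N.
    by rewrite -!halfE; exact: (congr1 (fun ij : 'I_k.+2 * 'I_k.+2 => nat_of_ord ij.1) eq_q).
  have eq_j : (j %/ 2 = j' %/ 2)%N.
    by rewrite -!halfE; exact: (congr1 (fun ij : 'I_k.+2 * 'I_k.+2 => nat_of_ord ij.2) eq_q).
  have zone_lt3 I : (zone k I < 3)%N by rewrite /zone; do 2?case: ifP.
  (* Both cells are now in the same 2 x 2 block, where distinct labels determine the position. *)
  move: eq_lab; rewrite /lab /stretch eq_i eq_j => /block_label_inj[];
    rewrite ?zone_lt3 ?ltn_mod // => mod_i mod_j.
  congr (_, _); apply: val_inj => /=.
    by rewrite (divn_eq i 2) eq_i mod_i -divn_eq.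
  by rewrite (divn_eq j 2) eq_j mod_j -divn_eq.
(* Each line meets a block in two cells, hence the factor 2; this is why diagonal sums of the odd
   square known only up to doubling suffice. *)
exists ((\sum_i a i + \sum_i b i) *+ 2 + (x + y *+ s)); split.
- move=> i; under eq_bigr do rewrite mxE.
  rewrite big_split /= (sum_half_ord (B (half i))) q_row; congr (_ + _).
  by rewrite -(sum_line x4 y2 odd_k (lab_row _ (stretch_lt6 k i))).
- move=> j; under eq_bigr do rewrite mxE.
  rewrite big_split /= (sum_half_ord (B ^~ (half j))) q_col; congr (_ + _).
  by rewrite -(sum_line x4 y2 odd_k (lab_col _ (stretch_lt6 k j))).
- under eq_bigr do rewrite mxE.
  rewrite big_split /= (sum_half_ord (fun i => B i i)) q_diag; congr (_ + _).
  by rewrite -(sum_line x4 y2 odd_k lab_diag).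
- under eq_bigr do rewrite mxE half_rev /lab stretch_rev.
  rewrite big_split /= (sum_half_ord (fun i => B i (rev_ord i))) q_anti.
  by rewrite -(sum_line x4 y2 odd_k lab_anti).
Qed.

(** * Odd sides, side 2, and the case split *)

Lemma odd_magic_square (G : finZmodType) (n : nat) (a b : 'I_n -> G) :
    odd n -> odd #|G| -> balanced a -> balanced b ->
    bijective (fun ij => a ij.1 + b ij.2) ->
  exists A : 'M[G]_n, is_magic_square A.
Proof.
move=> odd_n oddG ba bb ab_bij.
(* Odd order excludes 2-torsion, which removes the factor 2 from the diagonal sums. *)
have dbl_inj (x y : G) : x *+ 2 = y *+ 2 -> x = y.
  move=> eq2; apply/eqP; rewrite -subr_eq0; set d := x - y.
  have ord2 : (#[d]%g %| 2)%N.
    by rewrite order_dvdn; apply/eqP; rewrite FinRing.zmodXgE mulrnBl eq2 subrr.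
  have ordG : (#[d]%g %| #|G|)%N by rewrite -cardsT order_dvdG ?inE.
  rewrite -[d == 0]order_eq1 -dvdn1 -(eqP (_ : coprime 2 #|G|)) ?dvdn_gcd ?ord2 //.
  by rewrite coprime2n.
have [q [q_inj /(_ G a b ba bb)[q_row q_col q_diag q_anti]]] := odd_index_square odd_n.
exists (\matrix_(i, j) (a (q i j).1 + b (q i j).2)); split.
  have q_bij : bijective (fun ij => q ij.1 ij.2) := injF_bij q_inj.
  apply: (eq_bij (bij_comp ab_bij q_bij)) => [[i j]] /=.
  by rewrite mxE.
exists (\sum_i a i + \sum_i b i); split.
- by move=> i; under eq_bigr do rewrite mxE; exact: q_row.
- by move=> j; under eq_bigr do rewrite mxE; exact: q_col.
- by under eq_bigr do rewrite mxE; exact/dbl_inj/q_diag.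
- by under eq_bigr do rewrite mxE; exact/dbl_inj/q_anti.
Qed.

Lemma magic_square_side_neq2 (G : finZmodType) (A : 'M[G]_2) : ~ is_magic_square A.
Proof.
case=> /bij_inj A_inj [mu [row col _ _]].
have := row ord0; rewrite -(col ord0) !big_ord_recl !big_ord0 !addr0 => /addrI.
by move/(A_inj (ord0, lift ord0 ord0) (lift ord0 ord0, ord0)).
Qed.

Theorem theorem5p6 (G : finZmodType) (n : nat)
    (cardG : #|G| = (n ^ 2)%N) (n2_gt1 : (1 < n ^ 2)%N) :
  (exists A : 'M[G]_n, is_magic_square A) <-> (2 < n)%N.
Proof.
split=> [[A magicA] | n_gt2].
  case: n A magicA n2_gt1 cardG => [|[|[|n]]] // A magicA _ _.
  by case: (magic_square_side_neq2 magicA).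
have full (m : nat) (a b : 'I_m -> G) :
    #|G| = (m ^ 2)%N -> injective (fun ij => a ij.1 + b ij.2) ->
    bijective (fun ij => a ij.1 + b ij.2).
  move=> cardGm ab_inj; apply: inj_card_bij => //.
  by rewrite card_prod !card_ord cardGm mulnn.
have [odd_n | even_n] := boolP (odd n).
  have [] := @balanced_factorizationP G n n; first by rewrite cardG mulnn.
  move=> _ [a [b [_ ba bb _ ab_inj]]].
  apply: (odd_magic_square odd_n _ ba bb (full _ _ _ cardG ab_inj)).
  by rewrite cardG oddX odd_n orbT.
have [/dvdnP[m nE] | n4] := boolP (4 %| n)%N.
  have [] := @balanced_factorizationP G n n; first by rewrite cardG mulnn.
  move=> _ [a [b [_ ba bb _ ab_inj]]]; subst n.
  exact: (doubly_even_magic_square ba bb (full _ _ _ cardG ab_inj)).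
(* Here [n./2] is odd and at least 3, so it is [k.+2] with [k] odd. *)
have [k odd_k nE] : exists2 k, odd k & n = (k.+2 * 2)%N.
  by exists (n./2 - 2)%N; lia.
have cardG4 : #|G| = (4 * (k.+2 * k.+2))%N by rewrite cardG nE -mulnn; lia.
have [|K [a [b [cardK ba bb abK ab_inj]]]] := @balanced_factorizationP G k.+2 k.+2.
  by rewrite cardG4 dvdn_mull.
have [|P [_ [_ [cardP _ _ _ _]]]] := @balanced_factorizationP G 4 1.
  by rewrite cardG4 dvdn_mulr.
subst n.
exact: (singly_even_magic_square odd_k cardG cardK cardP ba bb abK ab_inj).
Qed.
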